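(* Let $P_0,P_1\in\mathbb{S}^n_{++}$ be positive definite matrices. If $\alpha\in\mathbb{R}$ satisfies $$|\alpha|<\max\left\{\frac{\lambda_{\rm min}(P_0)\lambda_{\rm min}(P_1)}{\|P_0\|_{\rm a}\,\lambda_{\rm max}(P_1)},\ \frac{\lambda_{\rm min}(P_0)\lambda_{\rm min}(P_1)}{\|P_1\|_{\rm a}\,\lambda_{\rm max}(P_0)}\right\},$$ then there exists a unique $\Pi\in\mathbb{S}^n$ that satisfies $$e^{\alpha(P_0\Pi-\Pi P_0)}\,e^{-P_0\Pi}\,P_0\,e^{-\Pi P_0}\,e^{\alpha(\Pi P_0-P_0\Pi)}=P_1.$$
   Context: $\mathbb{S}^n$ (resp. $\mathbb{S}^n_{++}$) is the set of real symmetric (resp. real symmetric positive definite) $n\times n$ matrices. $\lambda_{\rm min}(P)$ and $\lambda_{\rm max}(P)$ are the smallest and largest eigenvalues of $P\in\mathbb{S}^n$. For $P\in\mathbb{S}^n$, $$\|P\|_{\rm a}:=\max_{\Delta\in\mathbb{S}^n,\ \Delta\neq0}\frac{\|\Delta P-P\Delta\|}{\|\Delta\|},$$ where $\|\cdot\|$ is the Frobenius norm. By convention $\lambda/\|P\|_{\rm a}=+\infty$ for any $\lambda>0$ if $\|P\|_{\rm a}=0$. $e^X$ is the matrix exponential. *)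

(* Defs.v *)
From HB Require Import structures.
From mathcomp Require Import all_boot all_order all_algebra.
From mathcomp Require Import all_classical all_reals all_analysis.

Set Implicit Arguments.
Unset Strict Implicit.
Unset Printing Implicit Defensive.

Import Order.TTheory GRing.Theory Num.Theory.
Import numFieldTopology.Exports numFieldNormedType.Exports.

Local Open Scope classical_set_scope.
Local Open Scope ring_scope.

(* Square matrices are taken of size n.+1: the eigenvalues and the norm below
   have no meaning in dimension 0. *)

Definition posdefmx (R : realType) (n : nat) (P : 'M[R]_n.+1) : Prop :=
  P \is symmetricmx /\
  forall x : 'cV[R]_n.+1, x != 0 -> 0 < (x^T *m P *m x) 0 0.

(* For symmetric P the set of real eigenvalues is finite and nonempty, so inf
   and sup are its least and greatest elements. *)
Definition lambda_min (R : realType) (n : nat) (P : 'M[R]_n.+1) : R :=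
  inf [set a : R | eigenvalue P a].

Definition lambda_max (R : realType) (n : nat) (P : 'M[R]_n.+1) : R :=
  sup [set a : R | eigenvalue P a].

(* The norm `|A| provided by the library on matrices is the entrywise max. *)
Definition frobenius (R : realType) (n : nat) (A : 'M[R]_n.+1) : R :=
  Num.sqrt (\sum_i \sum_j A i j ^+ 2).

(* The quotient depends only on the direction of D, hence on a compact set of
   matrices D: the supremum is attained. *)
Definition anorm (R : realType) (n : nat) (P : 'M[R]_n.+1) : R :=
  sup [set frobenius (D * P - P * D) / frobenius D
      | D in [set D : 'M[R]_n.+1 | D \is symmetricmx /\ D != 0]].

Definition expmx (R : realType) (n : nat) (A : 'M[R]_n.+1) : 'M[R]_n.+1 :=
  limn (series (fun k : nat => (k`!%:R : R)^-1 *: A ^+ k)).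

(* Main.v *)
Require Import Defs.
From HB Require Import structures.
From mathcomp Require Import all_boot all_order all_algebra.
From mathcomp Require Import all_classical all_reals all_analysis.
From mathcomp Require Import complex.
From mathcomp Require Import ring lra.

Set Implicit Arguments.
Unset Strict Implicit.
Unset Printing Implicit Defensive.

Import Order.TTheory GRing.Theory Num.Theory.
Import numFieldTopology.Exports numFieldNormedType.Exports.

Local Open Scope ring_scope.
Local Open Scope classical_set_scope.

(** With B = sqrt P0 and S = B Pi B, the equation says that
      exp (- 2 S) = B^-1 U^T P1 U B^-1,   where U = exp (alpha (P0 Pi - Pi P0)),
    so Pi is a fixed point of the map sending Pi to the logarithm of the right-hand
    side. That map is a contraction for the Frobenius norm. Indeed the logarithm does
    not increase distances when positive definite matrices are compared through
    |X^(-1/2) (X - Y) Y^(-1/2)|, a quantity invariant under congruence, so B drops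
    out and only the commutator of P1 with the orthogonal matrix U1 U2^T remains;
    commutators with P are bounded by lambda_max P - lambda_min P, which is at most
    the norm anorm P. Existence and uniqueness follow from Banach's theorem. *)

(** * Diagonalization of real symmetric matrices *)

Lemma symmetricmxP (F : fieldType) (n : nat) (A : 'M[F]_n) :
  reflect (A^T = A) (A \is symmetricmx).
Proof.
apply: (iffP (is_hermitianmxP _ _ _)); rewrite expr0 scale1r map_mx_id //.
Qed.

(** Over the complex field [A] becomes Hermitian, hence unitarily diagonalizable with real spectrum.
    A real root of its characteristic polynomial descends to [R] through the embedding
    [real_complex]. *)
Lemma symmetric_eigenvalue (R : rcfType) (n : nat) (A : 'M[R]_n.+1) :
  A^T = A -> exists a, eigenvalue A a.
Proof.
move=> As; pose Ac := map_mx (real_complex R) A.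
have hA : Ac \is hermsymmx.
  apply: realsym_hermsym.
    by apply/symmetricmxP; rewrite /Ac map_trmx As.
  by apply/mxOverP => i j; rewrite mxE complex_real.
have /hermitian_normalmx /orthomx_spectralP dA := hA.
have /mxOverP/(_ 0 0) := hermitian_spectral_diag_real hA.
set D := spectral_diag Ac in dA *; set P := spectralmx Ac in dA.
have uP : P \in unitmx by exact: spectral_unit.
move=> /complex_realP [a Da]; exists a; have {}Da : D 0 0 = real_complex R a := Da.
suff : eigenvalue Ac (D 0 0).
  rewrite !eigenvalue_root_char Da -(fmorph_root (real_complex R)) map_char_poly.
  exact.
apply/eigenvalueP; exists (row 0 P).
  rewrite -row_mul {1}dA !mulmxA mulmxV // mul1mx row_mul row_diag_mx.
  by rewrite -scalemxAl -rowE.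
apply/eqP => /(congr1 (mulmx^~ (invmx P))).
rewrite -row_mul mulmxV // mul0mx => /rowP /(_ 0); rewrite !mxE eqxx /=.
by apply/eqP; rewrite oner_eq0.
Qed.

Lemma row_dotE (R : pzSemiRingType) (n : nat) (v : 'rV[R]_n) :
  (v *m v^T) 0 0 = \sum_j v 0 j ^+ 2.
Proof. by rewrite mxE; apply: eq_bigr => j _; rewrite mxE expr2. Qed.

Lemma row_dot_eq0 (R : realDomainType) (n : nat) (v : 'rV[R]_n) :
  (v *m v^T) 0 0 = 0 -> v = 0.
Proof.
rewrite row_dotE => h; apply/rowP => j; rewrite mxE; apply/eqP.
rewrite -sqrf_eq0; apply/eqP; apply: (psumr_eq0P _ h) => // i _.
exact: sqr_ge0.
Qed.

Lemma row_normalize (R : rcfType) (n : nat) (v : 'rV[R]_n) : v != 0 ->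
  exists2 c : R, c != 0 & (c *: v) *m (c *: v)^T = 1%:M.
Proof.
move=> v0; have s0 : 0 < (v *m v^T) 0 0.
  rewrite lt0r; apply/andP; split.
    by apply: contra_neq v0 => /row_dot_eq0.
  by rewrite row_dotE sumr_ge0 // => j _; rewrite sqr_ge0.
have vv : v *m v^T = ((v *m v^T) 0 0)%:M by exact: mx11_scalar.
move: ((v *m v^T) 0 0) vv s0 => s vv s0.
exists (Num.sqrt s)^-1; first by rewrite invr_neq0 // sqrtr_eq0 -ltNge.
rewrite linearZ /= -scalemxAl -scalemxAr scalerA vv scale_scalar_mx -expr2.
by rewrite exprVn sqr_sqrtr ?ltW // mulVf ?gt_eqF.
Qed.

(** Completes a unit eigenvector to an orthonormal basis, which is what the induction in
    [symmetric_spectral] needs. *)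
Lemma householder (R : realFieldType) (n : nat) (v : 'rV[R]_n.+1) :
  v *m v^T = 1%:M ->
  exists2 Q : 'M[R]_n.+1, Q *m Q^T = 1%:M & row 0 Q = v.
Proof.
move=> v1; pose e : 'rV[R]_n.+1 := delta_mx 0 0.
have [->|ne] := eqVneq v e.
  by exists 1%:M; [rewrite trmx1 mulmx1 | rewrite /e rowE mulmx1].
(* The reflection exchanging v and e. *)
pose w := v - e; pose s := (v *m e^T) 0 0.
have e1 : e *m e^T = 1%:M by rewrite trmx_delta mul_delta_mx; apply/matrixP=> i j; rewrite !ord1 !mxE.
have ve : v *m e^T = s%:M by rewrite [LHS]mx11_scalar.
have ev : e *m v^T = s%:M by rewrite -[e]trmxK -trmx_mul ve tr_scalar_mx.
have ww : w *m w^T = (2 - 2 * s)%:M.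
  rewrite /w linearB /= mulmxBl !mulmxBr v1 e1 ve ev.
  by apply/matrixP=> i j; rewrite !ord1 !mxE eqxx !mulr1n; ring.
have w0 : 2 - 2 * s != 0.
  apply: contra_neq ne => h; apply/eqP; rewrite -subr_eq0; apply/eqP.
  by apply: row_dot_eq0; rewrite -/w ww h !mxE.
(* Since [2 - 2 * s] is the squared length of [w], this is the coefficient of the reflection across
   the hyperplane orthogonal to [w]. *)
pose c := 2 / (2 - 2 * s).
pose K := w^T *m w.
have KK : K *m K = (2 - 2 * s) *: K.
  by rewrite /K mulmxA -(mulmxA w^T) ww mul_mx_scalar -scalemxAl.
have cc : c * c * (2 - 2 * s) = c + c by rewrite /c; field.
exists (1%:M - c *: K).
  have -> : (1%:M - c *: K)^T = 1%:M - c *: K.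
    by rewrite linearB /= trmx1 linearZ /= trmx_mul trmxK.
  rewrite mulmxBl mul1mx mulmxBr mulmx1 -scalemxAl -scalemxAr KK !scalerA cc scalerDl.
  by rewrite opprB addrK subrK.
rewrite rowE -/e mulmxBr mulmx1 -scalemxAr /K mulmxA.
have -> : e *m w^T = (s - 1)%:M.
  by rewrite /w linearB /= mulmxBr ev e1; apply/matrixP=> i j; rewrite !ord1 !mxE.
rewrite mul_scalar_mx scalerA.
have -> : c * (s - 1) = - 1 by rewrite /c; field.
by rewrite scaleN1r opprK /w addrC subrK.
Qed.

(** Deflation: in an orthonormal basis starting with an eigenvector, the first row is a multiple of
    the first basis vector. By symmetry the matrix is block diagonal, and induction applies to the
    lower block. *)
Theorem symmetric_spectral (R : rcfType) (n : nat) (A : 'M[R]_n) : A^T = A ->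
  exists (V : 'M[R]_n) (d : 'rV[R]_n),
    V *m V^T = 1%:M /\ A = V^T *m diag_mx d *m V.
Proof.
elim: n A => [|n IH] A As.
  by exists 1%:M, 0; split; apply/matrixP => -[].
have [a /eigenvalueP [v vA v0]] := symmetric_eigenvalue As.
have [c c0 cv1] := row_normalize v0.
have [Q QQ Q0] := householder cv1.
have QtQ : Q^T *m Q = 1%:M by apply: mulmx1C.
pose B : 'M[R]_(1 + n) := Q *m A *m Q^T.
have Bs : B^T = B by rewrite /B !trmx_mul trmxK As mulmxA.
have B0 : row 0 B = a *: delta_mx 0 0.
  rewrite /B !row_mul Q0 -(scalemxAl c v) vA scalerA mulrC -scalerA -scalemxAl.
  congr (_ *: _); rewrite -Q0 -row_mul QQ.
  by apply/rowP => j; rewrite !mxE eqxx /= eq_sym.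
have l0 : lshift n (ord0 : 'I_1) = 0 by apply: val_inj.
have Bul : ulsubmx B = a%:M.
  apply/matrixP => i j; have /rowP/(_ (lshift n j)) := B0.
  by rewrite !ord1 l0 !mxE /= mulr1 l0.
have Bur : ursubmx B = 0.
  apply/rowP => j; have /rowP/(_ (rshift 1 j)) := B0.
  by rewrite !mxE /= l0 => ->; rewrite mulr0.
have Bdl : dlsubmx B = 0.
  by rewrite -Bs -trmx_ursub Bur trmx0.
have [V [d [VV dB]]] := IH (drsubmx B) ltac:(by rewrite trmx_drsub Bs).
have BE : B = block_mx a%:M 0 0 (V^T *m diag_mx d *m V).
  by rewrite -[LHS]submxK Bul Bur Bdl dB.
(* The size [n.+1] is restated as the convertible [1 + n], on which block matrices operate. *)
suff: exists (W : 'M[R]_(1 + n)) (e : 'rV[R]_(1 + n)),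
    W *m W^T = 1%:M /\ (A : 'M[R]_(1 + n)) = W^T *m diag_mx e *m W by [].
have {}QQ : (Q : 'M[R]_(1 + n)) *m Q^T = 1%:M by [].
have -> : (A : 'M[R]_(1 + n)) = (Q : 'M[R]_(1 + n))^T *m B *m Q.
  by rewrite /B !mulmxA QtQ mul1mx -mulmxA QtQ mulmx1.
clear Q0 QtQ B0 Bs l0 Bul Bur Bdl dB; move: B BE => B BE; move: (Q : 'M[R]_(1 + n)) QQ => {}Q QQ.
exists (block_mx 1%:M 0 0 V *m Q), (row_mx (a%:M : 'rV_1) d); split.
  rewrite trmx_mul mulmxA -(mulmxA _ Q) QQ mulmx1 tr_block_mx mulmx_block.
  by rewrite !trmx0 trmx1 !mulmx0 !mul0mx !addr0 add0r mulmx1 VV scalar_mx_block.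
rewrite BE trmx_mul tr_block_mx diag_mx_row !mulmxA; congr (_ *m _).
rewrite -!mulmxA; congr (_ *m _).
rewrite !mulmx_block !trmx0 trmx1.
rewrite !mulmx0 !mul0mx !addr0 !add0r !mul1mx !mulmx1 !mulmxA.
by rewrite mulmx0; congr block_mx; apply/matrixP => i j; rewrite !mxE !ord1.
Qed.

(** * The Frobenius norm *)

(** Lagrange's identity: twice the gap between the two sides is the sum of the squares of the 2 by 2
    minors of x and y. *)
Lemma cauchy_schwarz_sum (F : realDomainType) (I : finType) (x y : I -> F) :
  (\sum_i x i * y i) ^+ 2 <= (\sum_i x i ^+ 2) * (\sum_i y i ^+ 2).
Proof.
set p := \sum_i x i * y i.
have : 0 <= \sum_i \sum_j (x i * y j - x j * y i) ^+ 2.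
  by apply: sumr_ge0 => i _; apply: sumr_ge0 => j _; exact: sqr_ge0.
have -> : \sum_i \sum_j (x i * y j - x j * y i) ^+ 2 =
    ((\sum_i x i ^+ 2) * (\sum_i y i ^+ 2)) *+ 2 - (p ^+ 2) *+ 2.
  pose f i j := x i ^+ 2 * y j ^+ 2.
  have e1 : \sum_i \sum_j f i j = (\sum_i x i ^+ 2) * (\sum_i y i ^+ 2).
    by rewrite mulr_suml; apply: eq_bigr => i _; rewrite mulr_sumr.
  have e2 : \sum_i \sum_j (x i * y i) * (x j * y j) = p ^+ 2.
    by rewrite expr2 mulr_suml; apply: eq_bigr => i _; rewrite mulr_sumr.
  have e3 : \sum_i \sum_j f j i = (\sum_i x i ^+ 2) * (\sum_i y i ^+ 2).
    by rewrite exchange_big.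
  rewrite [X in X - _]mulr2n -{1}e1 -e3 -e2 -sumrMnl -sumrN -!big_split /=.
  apply: eq_bigr => i _; rewrite -sumrMnl -sumrN -!big_split /=.
  by apply: eq_bigr => j _; rewrite /f; ring.
by rewrite subr_ge0 lerMn2r.
Qed.

Section Frobenius.
Variables (R : realType) (n : nat).
Implicit Types A B U : 'M[R]_n.+1.

Lemma frobenius_ge0 A : 0 <= frobenius A.
Proof. exact: sqrtr_ge0. Qed.

Lemma sumsqr_ge0 A : 0 <= \sum_i \sum_j A i j ^+ 2.
Proof. by apply: sumr_ge0 => i _; apply: sumr_ge0 => j _; exact: sqr_ge0. Qed.

Lemma sqr_frobenius A : frobenius A ^+ 2 = \sum_i \sum_j A i j ^+ 2.
Proof. by rewrite sqr_sqrtr // sumsqr_ge0. Qed.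

Lemma sqr_frobenius_tr A : frobenius A ^+ 2 = \tr (A * A^T).
Proof.
rewrite sqr_frobenius; apply: eq_bigr => i _; rewrite mxE.
by apply: eq_bigr => j _; rewrite mxE expr2.
Qed.

Lemma frobenius_le A B : frobenius A ^+ 2 <= frobenius B ^+ 2 ->
  frobenius A <= frobenius B.
Proof. by rewrite ler_pXn2r // nnegrE frobenius_ge0. Qed.

Lemma frobenius_eq A B : frobenius A ^+ 2 = frobenius B ^+ 2 ->
  frobenius A = frobenius B.
Proof.
by move=> h; apply/le_anti/andP; split; apply: frobenius_le; rewrite h.
Qed.

Lemma frobenius0 : frobenius (0 : 'M[R]_n.+1) = 0.
Proof.
rewrite /frobenius big1 ?sqrtr0 // => i _; rewrite big1 // => j _.
by rewrite mxE expr0n.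
Qed.

Lemma entry_le_frobenius A i j : `|A i j| <= frobenius A.
Proof.
rewrite -sqrtr_sqr; apply: ler_wsqrtr.
rewrite (bigD1 i) //= (bigD1 j) //= -addrA lerDl addr_ge0 //.
  by apply: sumr_ge0 => k _; exact: sqr_ge0.
by apply: sumr_ge0 => k _; apply: sumr_ge0 => l _; exact: sqr_ge0.
Qed.

Lemma frobenius_eq0 A : frobenius A = 0 -> A = 0.
Proof.
move=> h; apply/matrixP => i j; rewrite mxE; apply/eqP; rewrite -normr_le0 -h.
exact: entry_le_frobenius.
Qed.

Lemma frobenius_gt0 A : A != 0 -> 0 < frobenius A.
Proof.
move=> A0; rewrite lt0r frobenius_ge0 andbT.
by apply: contra_neq A0 => /frobenius_eq0.
Qed.

Lemma frobeniusZ (c : R) A : frobenius (c *: A) = `|c| * frobenius A.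
Proof.
rewrite -sqrtr_sqr /frobenius -sqrtrM ?sqr_ge0 //; congr Num.sqrt.
rewrite mulr_sumr; apply: eq_bigr => i _; rewrite mulr_sumr.
by apply: eq_bigr => j _; rewrite mxE exprMn.
Qed.

Lemma frobeniusN A : frobenius (- A) = frobenius A.
Proof. by rewrite -scaleN1r frobeniusZ normrN1 mul1r. Qed.

Lemma frobeniusBC A B : frobenius (A - B) = frobenius (B - A).
Proof. by rewrite -frobeniusN opprB. Qed.

Lemma frobenius_tr A : frobenius A^T = frobenius A.
Proof.
congr Num.sqrt; rewrite exchange_big; apply: eq_bigr => i _.
by apply: eq_bigr => j _; rewrite mxE.
Qed.

Lemma frobeniusD A B : frobenius (A + B) <= frobenius A + frobenius B.
Proof.
rewrite -(@ler_pXn2r _ 2) // ?nnegrE ?addr_ge0 ?frobenius_ge0 //.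
rewrite sqrrD !sqr_frobenius !pair_bigA /=.
have -> : \sum_(p : 'I_n.+1 * 'I_n.+1) (A + B) p.1 p.2 ^+ 2 =
   \sum_(p : 'I_n.+1 * 'I_n.+1) A p.1 p.2 ^+ 2 +
   (\sum_(p : 'I_n.+1 * 'I_n.+1) A p.1 p.2 * B p.1 p.2) *+ 2 +
   \sum_(p : 'I_n.+1 * 'I_n.+1) B p.1 p.2 ^+ 2.
  rewrite -sumrMnl -!big_split /=; apply: eq_bigr => p _.
  by rewrite mxE sqrrD.
rewrite lerD2r lerD2l lerMn2r /=.
apply: le_trans (ler_norm _) _; rewrite -sqrtr_sqr.
rewrite /frobenius -sqrtrM ?sumsqr_ge0 // !pair_bigA /=; apply: ler_wsqrtr.
exact: cauchy_schwarz_sum.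
Qed.

Lemma frobenius_sum (I : Type) (r : seq I) (P : pred I) (F : I -> 'M[R]_n.+1) :
  frobenius (\sum_(i <- r | P i) F i) <= \sum_(i <- r | P i) frobenius (F i).
Proof.
elim/big_ind2: _ => [|x1 x2 y1 y2 h1 h2|//]; first by rewrite frobenius0.
by apply: le_trans (frobeniusD _ _) _; apply: lerD.
Qed.

Lemma frobeniusM A B : frobenius (A * B) <= frobenius A * frobenius B.
Proof.
rewrite -(@ler_pXn2r _ 2) // ?nnegrE ?mulr_ge0 ?frobenius_ge0 //.
rewrite exprMn !sqr_frobenius mulr_suml; apply: ler_sum => i _.
rewrite exchange_big mulr_sumr; apply: ler_sum => j _.
rewrite mxE; exact: cauchy_schwarz_sum.
Qed.

Lemma frobenius_orthoMr U A : U * U^T = 1 -> frobenius (A * U) = frobenius A.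
Proof.
move=> hU; apply: frobenius_eq; rewrite !sqr_frobenius_tr trmx_mul.
by rewrite -mulrA (mulrA U) hU mul1r.
Qed.

Lemma orthoC U : U * U^T = 1 -> U^T * U = 1.
Proof. exact: mulmx1C. Qed.

Lemma frobenius_orthoMl U A : U * U^T = 1 -> frobenius (U * A) = frobenius A.
Proof.
move=> hU; rewrite -frobenius_tr trmx_mul frobenius_orthoMr ?frobenius_tr //.
by rewrite trmxK; exact: orthoC.
Qed.

Lemma frobenius_entrywise_le (c : R) A B : 0 <= c ->
  (forall i j, `|A i j| <= c * `|B i j|) -> frobenius A <= c * frobenius B.
Proof.
move=> c0 h; rewrite -(ger0_norm c0) -frobeniusZ.
apply: ler_wsqrtr; apply: ler_sum => i _; apply: ler_sum => j _.
rewrite mxE -(real_normK (num_real (A i j))) -(real_normK (num_real (_ * _))).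
by rewrite ler_pXn2r ?nnegrE // normrM (ger0_norm c0).
Qed.

End Frobenius.

(** * Convergence of the exponential series *)

(** Makes the absolute convergence criterion and Banach's theorem applicable to matrices. *)
HB.instance Definition _ (R : realType) (m n : nat) := Complete.on 'M[R]_(m, n).

Section ExpSeries.
Variables (R : realType) (n : nat).
Implicit Types A B U : 'M[R]_n.+1.

Definition exp_partial A : nat -> 'M[R]_n.+1 :=
  series (fun k => (k`!%:R : R)^-1 *: A ^+ k).

Lemma norm_le_frobenius A : `|A| <= frobenius A.
Proof.
rewrite [leLHS]mx_normrE; apply: bigmax_le => [|i _].
  exact: frobenius_ge0.
exact: entry_le_frobenius.
Qed.

Lemma frobenius_le_norm A : frobenius A <= n.+1%:R * `|A|.
Proof.
rewrite -(ger0_norm (_ : 0 <= n.+1%:R * `|A|)) ?mulr_ge0 // -sqrtr_sqr.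
apply: ler_wsqrtr.
have h i j : A i j ^+ 2 <= `|A| ^+ 2.
  rewrite -(real_normK (num_real (A i j))) ler_pXn2r ?nnegrE //.
  rewrite [leRHS]mx_normrE.
  exact: (le_bigmax _ (fun ij : 'I_n.+1 * 'I_n.+1 => `|A ij.1 ij.2|) (i, j)).
apply: (@le_trans _ _ (\sum_(i < n.+1) \sum_(j < n.+1) `|A| ^+ 2)).
  by apply: ler_sum => i _; apply: ler_sum => j _.
by rewrite !sumr_const !card_ord exprMn -mulrnA -[leLHS]mulr_natl natrM -expr2.
Qed.

(** The topology on matrices comes from the entrywise max norm. The two preceding inequalities make
    both norms equivalent, so limits can be computed with [frobenius]. *)
Lemma cvg_frobenius (u : nat -> 'M[R]_n.+1) L :
  (frobenius (u k - L) @[k --> \oo] --> (0 : R)) <-> (u @ \oo --> L).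
Proof.
split=> [h|/cvgr_dist_lt h].
  apply/cvgrPdist_lt => e e0; move/cvgr0_norm_lt: h => /(_ e e0).
  apply: filterS => k; rewrite ger0_norm ?frobenius_ge0 // distrC.
  by apply: le_lt_trans; exact: norm_le_frobenius.
apply/cvgr0Pnorm_lt => e e0.
have := h (e / n.+1%:R) (divr_gt0 e0 (ltr0Sn _ _)).
apply: filterS => k; rewrite ger0_norm ?frobenius_ge0 // distrC => hk.
apply: le_lt_trans (frobenius_le_norm _) _.
by rewrite mulrC -ltr_pdivlMr.
Qed.

Lemma cvg_comp_frobenius (u : nat -> 'M[R]_n.+1) L :
  u @ \oo --> L -> frobenius (u k) @[k --> \oo] --> frobenius L.
Proof.
move/cvg_frobenius => h; apply/cvgrPdist_lt => e e0.
move/cvgr0_norm_lt: h => /(_ e e0); apply: filterS => k.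
rewrite ger0_norm ?frobenius_ge0 //; apply: le_lt_trans.
have := frobeniusD (u k - L) L; have := frobeniusD (L - u k) (u k).
by rewrite !subrK (frobeniusBC L) ler_norml; lra.
Qed.

Lemma cvg_lipschitz (f : 'M[R]_n.+1 -> 'M[R]_n.+1) (K : R)
    (u : nat -> 'M[R]_n.+1) L :
  (forall X Y, frobenius (f X - f Y) <= K * frobenius (X - Y)) ->
  u @ \oo --> L -> f (u k) @[k --> \oo] --> f L.
Proof.
move=> fK /cvg_frobenius h; apply/cvg_frobenius.
apply: (@squeeze_cvgr _ _ _ _ (fun=> 0) (fun k => K * frobenius (u k - L))).
- by apply: nearW => k; rewrite frobenius_ge0 fK.
- exact: cvg_cst.
- by rewrite -(mulr0 K); apply: cvgMl_tmp.
Qed.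

(** The leading factor [A] absorbs the exponent 0: the Frobenius norm of the identity exceeds 1 in
    general, so a bound on bare powers would fail there. *)
Lemma frobeniusMX A B k : frobenius (A * B ^+ k) <= frobenius A * frobenius B ^+ k.
Proof.
elim: k => [|k IH]; first by rewrite !expr0 !mulr1.
rewrite !exprSr !mulrA; apply: le_trans (frobeniusM _ _) _.
by apply: ler_wpM2r => //; exact: frobenius_ge0.
Qed.

Lemma cvg_exp_partial A : exp_partial A @ \oo --> expmx A.
Proof.
suff : cvgn (exp_partial A) by [].
apply: normed_cvg; apply: (@series_le_cvg _ _
    (frobenius (1 : 'M[R]_n.+1) *: exp_coeff (frobenius A))) => [k|k|k|].
- exact: normr_ge0.
- by rewrite mulr_ge0 ?frobenius_ge0 // exp_coeff_ge0 // frobenius_ge0.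
- apply: le_trans (norm_le_frobenius _) _; rewrite frobeniusZ.
  rewrite normfV normr_nat mulrC -[leRHS]/(_ * (_ / _)) mulrA.
  apply: ler_wpM2r; first by rewrite invr_ge0.
  by rewrite -[A ^+ k]mul1r; exact: frobeniusMX.
- by apply: is_cvg_seriesZ; exact: is_cvg_series_exp_coeff.
Qed.

Lemma expmx_eq A L : exp_partial A @ \oo --> L -> expmx A = L.
Proof.
by move=> h; apply: cvg_unique (@cvg_exp_partial A) h; exact: norm_hausdorff.
Qed.

Lemma exp_partialE A N :
  exp_partial A N = \sum_(0 <= k < N) (k`!%:R : R)^-1 *: A ^+ k.
Proof. by []. Qed.

Lemma exp_partial_le_expR (a : R) N : 0 <= a ->
  series (exp_coeff a) N <= expR a.
Proof.
move=> a0; apply: nondecreasing_cvgn_le; last exact: is_cvg_series_exp_coeff.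
by apply: nondecreasing_series => k _ _; exact: exp_coeff_ge0.
Qed.

(** A bounded linear map passes through the limit of the partial sums. This covers both
    transposition and conjugation. *)
Lemma expmx_map (f : {linear 'M[R]_n.+1 -> 'M[R]_n.+1}) (K : R) A B :
  (forall X, frobenius (f X) <= K * frobenius X) ->
  (forall k, B ^+ k = f (A ^+ k)) -> expmx B = f (expmx A).
Proof.
move=> fK fX; apply: expmx_eq.
have -> : exp_partial B = f \o exp_partial A.
  apply: funext => N; rewrite /= !exp_partialE linear_sum.
  by apply: eq_bigr => k _; rewrite fX linearZ.
apply: cvg_lipschitz (@cvg_exp_partial A) => X Y; rewrite -[f X - f Y](linearB f); exact: fK.
Qed.

Lemma expmx_tr A : expmx A^T = (expmx A)^T.
Proof.
apply: (@expmx_map trmx 1) => [X|k]; first by rewrite frobenius_tr mul1r.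
by elim: k => [|k IH]; [rewrite !expr0 [RHS]trmx1 | rewrite exprSr IH exprS [RHS]trmx_mul].
Qed.

Lemma expmx_conj V W A : W * V = 1 -> expmx (V * A * W) = V * expmx A * W.
Proof.
move=> WV; pose f := mulmxr W \o mulmx V : {linear 'M[R]_n.+1 -> 'M[R]_n.+1}.
apply: (@expmx_map f (frobenius V * frobenius W)) => [X|k].
  apply: le_trans (frobeniusM _ _) _; rewrite mulrAC.
  apply: ler_wpM2r; first exact: frobenius_ge0.
  exact: frobeniusM.
rewrite /f /=; elim: k => [|k IH].
  by rewrite !expr0 [V *m 1]mulr1; apply/esym/mulmx1C.
rewrite exprSr IH exprSr.
have -> : V *m A ^+ k *m W * (V * A * W) = V * A ^+ k * (W * V) * A * W.
  by rewrite !mulrA.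
by rewrite WV mulr1 -(mulrA V).
Qed.

Lemma expmx_diag (d : 'rV[R]_n.+1) :
  expmx (diag_mx d) = diag_mx (map_mx expR d).
Proof.
apply/matrixP => i j; rewrite !mxE.
have h : (exp_partial (diag_mx d) N i j) @[N --> \oo] --> expmx (diag_mx d) i j.
  exact: (continuous_cvg _ (@coord_continuous _ _ _ i j _) (@cvg_exp_partial _)).
suff : (exp_partial (diag_mx d) N i j) @[N --> \oo] --> expR (d 0 i) *+ (i == j).
  by move=> h2; rewrite -(cvg_lim (@Rhausdorff R) h) -(cvg_lim (@Rhausdorff R) h2).
rewrite (_ : (fun N => exp_partial (diag_mx d) N i j) =
    (fun N => series (exp_coeff (d 0 i)) N *+ (i == j))); last first.
  apply: funext => N; rewrite exp_partialE summxE /series -sumrMnl.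
  apply: eq_bigr => k _; rewrite mxE.
  have -> : (diag_mx d ^+ k) = diag_mx (map_mx (fun x => x ^+ k) d).
    elim: k => [|k IH].
      by apply/matrixP => p q; rewrite !mxE expr0.
    rewrite exprS IH [LHS]mulmx_diag; congr diag_mx.
    by apply/rowP => p; rewrite !mxE exprS.
  by rewrite !mxE mulrnAr mulrC.
case: (i == j); last by rewrite mulr0n; exact: cvg_cst.
rewrite mulr1n; exact: is_cvg_series_exp_coeff.
Qed.

End ExpSeries.

(** * Exponentials of sums and Lipschitz bounds *)

(** Two ways of summing over the triangle i + j < N, for the Cauchy product of exponential
    series. *)
Lemma sum_antidiagonals (V : nmodType) (F : nat -> nat -> V) (N : nat) :
  \sum_(0 <= m < N) \sum_(0 <= i < m.+1) F i (m - i)%N =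
  \sum_(0 <= i < N) \sum_(0 <= j < N - i) F i j.
Proof.
elim: N => [|N IH]; first by rewrite !big_nil.
rewrite big_nat_recr //= IH.
transitivity (\sum_(0 <= i < N.+1) (\sum_(0 <= j < N - i) F i j + F i (N - i)%N)).
  rewrite big_split /=; congr (_ + _).
  by rewrite big_nat_recr //= subnn [X in _ + X]big_nil addr0.
rewrite !big_nat; apply: eq_bigr => i /andP[_ iN].
by rewrite subSn // big_nat_recr.
Qed.

Section ExpSum.
Variables (K : numFieldType) (T : algType K).
Implicit Types x y : T.

Definition exp_sum x (N : nat) : T := \sum_(0 <= k < N) (k`!%:R : K)^-1 *: x ^+ k.

(** By the binomial formula, [exp_sum (x + y) N] collects the terms of the product with i + j < N;
    the rest of the square remains, with positive coefficients. The algebra is arbitrary so that the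
    identity serves both for matrices and for their norms. *)
Lemma exp_sumM_sub x y N : GRing.comm x y ->
  exp_sum x N * exp_sum y N - exp_sum (x + y) N =
  \sum_(0 <= i < N) \sum_(N - i <= j < N)
    ((j`!%:R : K)^-1 * (i`!%:R)^-1) *: (x ^+ j * y ^+ i).
Proof.
move=> cxy; pose F i j := ((j`!%:R : K)^-1 * (i`!%:R)^-1) *: (x ^+ j * y ^+ i).
have -> : exp_sum (x + y) N = \sum_(0 <= i < N) \sum_(0 <= j < N - i) F i j.
  rewrite -sum_antidiagonals; apply: eq_bigr => m _.
  rewrite exprDn_comm // scaler_sumr big_mkord; apply: eq_bigr => i _.
  rewrite /F -[_ *+ 'C(_, _)]scaler_nat scalerA; congr (_ *: _).
  have im : (i <= m)%N by rewrite -ltnS.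
  rewrite -(bin_fact im) !natrM; field.
  by rewrite !pnatr_eq0 -!lt0n !fact_gt0 bin_gt0 im.
have -> : exp_sum x N * exp_sum y N = \sum_(0 <= i < N) \sum_(0 <= j < N) F i j.
  rewrite mulr_sumr; apply: eq_bigr => i _; rewrite mulr_suml.
  by apply: eq_bigr => j _; rewrite -scalerAl -scalerAr scalerA.
rewrite -sumrB; apply: eq_bigr => i _.
by rewrite (big_cat_nat _ (leq_subr i N)) //= [LHS]addrAC subrr add0r.
Qed.

End ExpSum.

Section ExpGroup.
Variables (R : realType) (n : nat).
Implicit Types A B U : 'M[R]_n.+1.

Lemma exp_sum_cvg (a : R) : exp_sum (a : R^o) N @[N --> \oo] --> expR a.
Proof.
rewrite (_ : exp_sum _ = series (exp_coeff a)); first exact: is_cvg_series_exp_coeff.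
by apply: funext => N; apply: eq_bigr => k _; rewrite /exp_coeff /= mulrC.
Qed.

Lemma cvg_mulmx (u v : nat -> 'M[R]_n.+1) A B :
  u @ \oo --> A -> v @ \oo --> B -> u k * v k @[k --> \oo] --> A * B.
Proof.
move=> uA vB; apply/cvg_frobenius.
apply: (@squeeze_cvgr _ _ _ _ (fun=> 0) (fun k =>
  frobenius (u k) * frobenius (v k - B) + frobenius (u k - A) * frobenius B)).
- apply: nearW => k; rewrite frobenius_ge0 /=.
  have -> : u k * v k - A * B = u k * (v k - B) + (u k - A) * B.
    by rewrite mulrBr mulrBl addrA subrK.
  by apply: le_trans (frobeniusD _ _) _; apply: lerD; exact: frobeniusM.
- exact: cvg_cst.
- rewrite -[0](_ : frobenius A * 0 + 0 * frobenius B = 0); last by rewrite mulr0 mul0r addr0.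
  apply: cvgD; first by apply: cvgM; [exact: cvg_comp_frobenius | exact/cvg_frobenius].
  by apply: cvgMr_tmp; exact/cvg_frobenius.
Qed.

(** The defect [D N] of the partial sums is dominated term by term by the same defect [d N] for the
    real numbers [a] and [b], which tends to 0 by the addition formula for [expR]. *)
Lemma expmxD A B : A * B = B * A -> expmx (A + B) = expmx A * expmx B.
Proof.
move=> cAB; apply: expmx_eq.
pose D N := exp_partial A N * exp_partial B N - exp_partial (A + B) N.
pose a := frobenius A; pose b := frobenius B.
pose d N : R^o := exp_sum (a : R^o) N * exp_sum (b : R^o) N - exp_sum (a + b : R^o) N.
have Dd N : frobenius (D N) <= frobenius (1 : 'M[R]_n.+1) * d N.
  rewrite /D /d !exp_sumM_sub //; last by rewrite /GRing.comm mulrC.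
  rewrite mulr_sumr; apply: le_trans (frobenius_sum _ _ _) _.
  apply: ler_sum => i _; rewrite mulr_sumr.
  apply: le_trans (frobenius_sum _ _ _) _; apply: ler_sum => j _.
  rewrite frobeniusZ ger0_norm ?mulr_ge0 ?invr_ge0 //.
  rewrite [leRHS]mulrCA; apply: ler_wpM2l; first by rewrite mulr_ge0 ?invr_ge0.
  apply: le_trans (frobeniusMX _ _ _) _; rewrite [leRHS]mulrA.
  apply: ler_wpM2r; first by rewrite exprn_ge0 ?frobenius_ge0.
  by rewrite -[A ^+ j]mul1r; exact: frobeniusMX.
have d0 : d N @[N --> \oo] --> (0 : R).
  rewrite (_ : 0 = expR a * expR b - expR (a + b)); last by rewrite expRD subrr.
  by apply: cvgB; [apply: cvgM|]; exact: exp_sum_cvg.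
have D0 : D N @[N --> \oo] --> (0 : 'M[R]_n.+1).
  apply/cvg_frobenius; apply: (@squeeze_cvgr _ _ _ _ (fun=> 0)
    (fun N => frobenius (1 : 'M[R]_n.+1) * d N)).
  - by apply: nearW => N; rewrite subr0 frobenius_ge0 Dd.
  - exact: cvg_cst.
  - by rewrite -[0](mulr0 (frobenius (1 : 'M[R]_n.+1))); apply: cvgMl_tmp.
have AB : exp_partial A N * exp_partial B N @[N --> \oo] --> expmx A * expmx B.
  by apply: cvg_mulmx; exact: cvg_exp_partial.
rewrite (_ : exp_partial (A + B) = fun N => exp_partial A N * exp_partial B N - D N).
  by rewrite -[expmx A * _]subr0; exact: cvgB.
by apply: funext => N; rewrite /D opprB [RHS]addrC subrK.
Qed.

Lemma expmx0 : expmx (0 : 'M[R]_n.+1) = 1.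
Proof.
rewrite (_ : 0 = diag_mx (0 : 'rV[R]_n.+1)); last by rewrite linear0.
rewrite expmx_diag (_ : map_mx _ _ = const_mx 1) ?diag_const_mx //.
by apply/rowP => i; rewrite !mxE expR0.
Qed.

Lemma expmxMN A : expmx A * expmx (- A) = 1.
Proof. by rewrite -expmxD ?subrr ?expmx0 // mulrN mulNr. Qed.

Lemma expmxNM A : expmx (- A) * expmx A = 1.
Proof. by rewrite -{2}(opprK A) expmxMN. Qed.

Lemma expmx_skew_ortho A : A^T = - A -> expmx A * (expmx A)^T = 1.
Proof. by move=> As; rewrite -expmx_tr As expmxMN. Qed.

Lemma expmx_natX A k : expmx (k%:R *: A) = expmx A ^+ k.
Proof.
elim: k => [|k IH]; first by rewrite scale0r expmx0 expr0.
rewrite -[k.+1]addn1 natrD scalerDl scale1r expmxD ?IH ?exprSr ?addn1 ?exprSr //.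
by rewrite -scalerAl -scalerAr.
Qed.

(** Telescoping: replacing the factors [A] by [B] one at a time costs one difference and k remaining
    factors bounded by [M]. *)
Lemma frobenius_subX (M : R) A B k : frobenius A <= M -> frobenius B <= M ->
  frobenius (A ^+ k.+1 - B ^+ k.+1) <= k.+1%:R * M ^+ k * frobenius (A - B).
Proof.
move=> hA hB; have M0 : 0 <= M := le_trans (frobenius_ge0 A) hA.
elim: k => [|k IH]; first by rewrite !expr1 expr0 !mul1r.
have -> : A ^+ k.+2 - B ^+ k.+2 = A * (A ^+ k.+1 - B ^+ k.+1) + (A - B) * B ^+ k.+1.
  by rewrite mulrBr mulrBl addrA -!exprS subrK.
apply: le_trans (frobeniusD _ _) _.
have h1 : frobenius (A * (A ^+ k.+1 - B ^+ k.+1)) <=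
    M * (k.+1%:R * M ^+ k * frobenius (A - B)).
  apply: le_trans (frobeniusM _ _) _; apply: ler_pM => //; exact: frobenius_ge0.
have h2 : frobenius ((A - B) * B ^+ k.+1) <= frobenius (A - B) * M ^+ k.+1.
  apply: le_trans (frobeniusMX _ _ _) _; apply: ler_wpM2l; first exact: frobenius_ge0.
  by rewrite ler_pXn2r ?nnegrE ?frobenius_ge0.
apply: le_trans (lerD h1 h2) _.
by rewrite -[k.+2]addn1 natrD exprS; lra.
Qed.

Lemma expmx_lipschitz (M : R) A B : frobenius A <= M -> frobenius B <= M ->
  frobenius (expmx A - expmx B) <= expR M * frobenius (A - B).
Proof.
move=> hA hB; have M0 : 0 <= M := le_trans (frobenius_ge0 A) hA.
have h : exp_partial A N - exp_partial B N @[N --> \oo] --> expmx A - expmx B.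
  by apply: cvgB; exact: cvg_exp_partial.
apply: (cvgr_to_le (cvg_comp_frobenius h)); apply: nearW => -[|N].
  by rewrite !exp_partialE !big_nil subrr frobenius0 mulr_ge0 ?expR_ge0 ?frobenius_ge0.
apply: le_trans (_ : series (exp_coeff M) N * frobenius (A - B) <= _); last first.
  by apply: ler_wpM2r; [exact: frobenius_ge0 | exact: exp_partial_le_expR].
(* The constant terms cancel. In the term of degree k + 1, the factor k + 1 from [frobenius_subX]
   turns the coefficient into that of degree k in the series of [expR M]. *)
rewrite !exp_partialE -sumrB big_nat_recl //= !expr0 subrr add0r /series mulr_suml.
apply: le_trans (frobenius_sum _ _ _) _; apply: ler_sum => k _.
rewrite -scalerBr frobeniusZ ger0_norm ?invr_ge0 //.
apply: le_trans (ler_wpM2l _ (frobenius_subX k hA hB)) _; first by rewrite invr_ge0.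
rewrite mulrA; apply: ler_wpM2r; first exact: frobenius_ge0.
rewrite /exp_coeff /= factS natrM; rewrite le_eqVlt; apply/orP; left; apply/eqP; field; by rewrite nat1r !pnatr_eq0 -!lt0n fact_gt0.
Qed.

(** Same telescoping, but orthogonal factors are isometries for [frobenius], so no power of a bound
    appears. *)
Lemma frobenius_ortho_subX U V k : U * U^T = 1 -> V * V^T = 1 ->
  frobenius (U ^+ k - V ^+ k) <= k%:R * frobenius (U - V).
Proof.
move=> hU hV; elim: k => [|k IH]; first by rewrite !expr0 subrr frobenius0 mul0r.
have -> : U ^+ k.+1 - V ^+ k.+1 = U * (U ^+ k - V ^+ k) + (U - V) * V ^+ k.
  by rewrite mulrBr mulrBl addrA -!exprS subrK.
apply: le_trans (frobeniusD _ _) _.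
rewrite frobenius_orthoMl // frobenius_orthoMr; first by rewrite -natr1 mulrDl mul1r lerD2r.
elim: (k) => [|m hm]; first by rewrite expr0 [_^T]trmx1 mulr1.
by rewrite exprSr [_^T]trmx_mul -mulrA (mulrA V) hV mul1r.
Qed.

(* Write e^A = (e^(A/m))^m with e^(A/m) orthogonal: the m-th power costs only a
   factor m, so the constant e^M of expmx_lipschitz improves to e^(M/m) <= 2. *)
Lemma expmx_skew_lipschitz A B : A^T = - A -> B^T = - B ->
  frobenius (expmx A - expmx B) <= 2 * frobenius (A - B).
Proof.
move=> As Bs; pose M := frobenius A + frobenius B.
have M0 : 0 <= M by rewrite addr_ge0 ?frobenius_ge0.
have l2 : 0 < ln (2 : R) by rewrite ln_gt0 // ltr1n.
pose m := (Num.truncn (M / ln 2)).+1.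
have mM : M / m%:R <= ln 2.
  rewrite ler_pdivrMr // mulrC -ler_pdivrMr //; apply: ltW.
  by rewrite -truncn_lt_nat // divr_ge0 // ltW.
have m0 : 0 < m%:R^-1 :> R by rewrite invr_gt0.
have e (C : 'M[R]_n.+1) : expmx C = expmx (m%:R^-1 *: C) ^+ m.
  by rewrite -expmx_natX scalerA mulfV ?scale1r // pnatr_eq0.
have sk (C : 'M[R]_n.+1) : C^T = - C -> (m%:R^-1 *: C)^T = - (m%:R^-1 *: C).
  by move=> Cs; rewrite linearZ /= Cs scalerN.
have nrm (C : 'M[R]_n.+1) : frobenius C <= M -> frobenius (m%:R^-1 *: C) <= ln 2.
  move=> CM; rewrite frobeniusZ gtr0_norm // mulrC; apply: le_trans mM.
  by rewrite ler_wpM2r // ltW.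
rewrite (e A) (e B); apply: le_trans (frobenius_ortho_subX m _ _) _.
- exact/expmx_skew_ortho/sk.
- exact/expmx_skew_ortho/sk.
apply: le_trans (ler_wpM2l _ (@expmx_lipschitz (ln 2) _ _ _ _)) _ => //.
- by apply: nrm; rewrite lerDl frobenius_ge0.
- by apply: nrm; rewrite lerDr frobenius_ge0.
rewrite lnK ?posrE // -scalerBr frobeniusZ gtr0_norm // mulrCA.
by rewrite (mulrA m%:R) mulfV ?mul1r // pnatr_eq0.
Qed.

End ExpGroup.

(** * Estimates in orthonormal eigenbases *)

(** Mean value theorem: the derivative [expR t + expR (- t)] is at least 2, because [expR t] is at
    least 1 + t. *)
Lemma sinh_lower_bound (R : realType) (x : R) :
  2 * `|x| <= `|expR x - expR (- x)|.
Proof.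
wlog x0 : x / 0 <= x => [h|].
  have [|/ltW xn] := leP 0 x; first exact: h.
  by have := h (- x); rewrite oppr_ge0 normrN opprK distrC; apply.
have [->|xn0] := eqVneq x 0; first by rewrite oppr0 subrr !normr0 mulr0.
have {xn0} xp : 0 < x by rewrite lt0r xn0.
pose f (t : R) : R := expR t - expR (- t).
have df (t : R) : is_derive t 1 f (expR t + expR (- t)).
  by rewrite /f; apply: is_derive_eq; rewrite mulrN1 opprK.
have cf : {within `[0, x], continuous f}.
  by apply: derivable_within_continuous => t _; case: (df t).
have [c _ fc] := MVT_segment x0 (fun t _ => df t) cf.
move: fc; rewrite /f oppr0 subrr subr0 addr0 => ->.
rewrite (ger0_norm x0) ger0_norm; last by rewrite mulr_ge0 // addr_ge0 ?expR_ge0.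
apply: ler_wpM2r => //.
by have := expR_ge1Dx c; have := expR_ge1Dx (- c); lra.
Qed.

Section Diagonalized.
Variables (R : realType) (n : nat).
Implicit Types A P U V X : 'M[R]_n.+1.
Implicit Types d e : 'rV[R]_n.+1.

Lemma trmxM A X : (A * X)^T = X^T * A^T.
Proof. exact: trmx_mul. Qed.

Definition ortho_diag V d : 'M[R]_n.+1 := V^T * diag_mx d * V.

Lemma ortho_diag_tr V d : (ortho_diag V d)^T = ortho_diag V d.
Proof. by rewrite /ortho_diag !trmxM tr_diag_mx trmxK mulrA. Qed.

Lemma ortho_diagN V d : - ortho_diag V d = ortho_diag V (- d).
Proof. by rewrite /ortho_diag linearN /= mulrN mulNr. Qed.

Lemma ortho_diagM V d e : V * V^T = 1 ->
  ortho_diag V d * ortho_diag V e = ortho_diag V (\row_i (d 0 i * e 0 i)).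
Proof.
move=> hV; rewrite /ortho_diag !mulrA -(mulrA _ V) hV mulr1.
by rewrite -(mulrA V^T) [diag_mx d * _]mulmx_diag.
Qed.

Lemma ortho_diag1 V : V * V^T = 1 -> ortho_diag V (const_mx 1) = 1.
Proof. by move=> hV; rewrite /ortho_diag diag_const_mx mulr1; exact: orthoC. Qed.

Lemma expmx_ortho_diag V d : V * V^T = 1 ->
  expmx (ortho_diag V d) = ortho_diag V (map_mx expR d).
Proof. by move=> hV; rewrite /ortho_diag expmx_conj // expmx_diag. Qed.

Lemma frobenius_conj U V X : U * U^T = 1 -> V * V^T = 1 ->
  frobenius (V * X * U^T) = frobenius X.
Proof.
move=> hU hV; rewrite frobenius_orthoMr ?trmxK ?frobenius_orthoMl //.
exact: orthoC.
Qed.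

(** The matrix [V * X * U^T] is [X] read in the row basis of [V] on the left and of [U] on the
    right. In these bases the outer factors act as scalars on each entry. *)
Lemma ortho_diag_frameE U V X d e i j : U * U^T = 1 -> V * V^T = 1 ->
  (V * (ortho_diag V d * X * ortho_diag U e) * U^T) i j =
  d 0 i * (V * X * U^T) i j * e 0 j.
Proof.
move=> hU hV; rewrite /ortho_diag !mulrA hV mul1r -(mulrA _ U) hU mulr1.
rewrite -(mulrA (diag_mx d)) -(mulrA (diag_mx d)) -!mulmxE mul_mx_diag mxE mul_diag_mx mxE.
by [].
Qed.

(** Main tool for norm estimates: orthogonal changes of basis, possibly different on the two sides,
    preserve [frobenius], so scalar inequalities between entries suffice. *)
Lemma ortho_diag_frame_le (c : R) U V X Y : U * U^T = 1 -> V * V^T = 1 ->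
  0 <= c ->
  (forall i j, `|(V * X * U^T) i j| <= c * `|(V * Y * U^T) i j|) ->
  frobenius X <= c * frobenius Y.
Proof.
move=> hU hV c0 h; rewrite -(frobenius_conj X hU hV) -(frobenius_conj Y hU hV).
exact: frobenius_entrywise_le.
Qed.

Lemma frameB U V X Y i j :
  (V * (X - Y) * U^T) i j = (V * X * U^T) i j - (V * Y * U^T) i j.
Proof. by rewrite mulrBr mulrBl !mxE. Qed.

Lemma frameZ (c : R) U V X i j :
  (V * (c *: X) * U^T) i j = c * (V * X * U^T) i j.
Proof. by rewrite -scalerAr -scalerAl mxE. Qed.

Theorem symmetric_ortho_diag A : A^T = A ->
  exists V d, V * V^T = 1 /\ A = ortho_diag V d.
Proof. by move=> /symmetric_spectral [V [d [hV hA]]]; exists V, d. Qed.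

(* Over an eigenbasis of A on the left and of B on the right, the coefficients
   a - b of A - B become 2 sinh (b - a). *)
Lemma expmx_symmetric_expand A B : A^T = A -> B^T = B ->
  2 * frobenius (A - B) <=
  frobenius (expmx (- A) * expmx B - expmx A * expmx (- B)).
Proof.
move=> /symmetric_ortho_diag [V [d [hV ->]]] /symmetric_ortho_diag [U [e [hU ->]]].
rewrite -(@ger0_norm _ 2) // -frobeniusZ -[leRHS]mul1r.
apply: (ortho_diag_frame_le hU hV) => // i j; rewrite mul1r.
have expN W a : W * W^T = 1 ->
    expmx (- ortho_diag W a) = ortho_diag W (map_mx expR (- a)).
  by move=> hW; rewrite ortho_diagN expmx_ortho_diag.
rewrite !expN // !expmx_ortho_diag // scalerBr !frameB.
(* The identity is inserted as [ortho_diag] of a constant, to give every term the shape required by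
   [ortho_diag_frameE]. *)
have -> : ortho_diag V d = ortho_diag V d * 1 * ortho_diag U (const_mx 1).
  by rewrite ortho_diag1 ?mulr1.
have -> : ortho_diag U e = ortho_diag V (const_mx 1) * 1 * ortho_diag U e.
  by rewrite ortho_diag1 ?mul1r.
rewrite -(mulr1 (ortho_diag V (map_mx expR (- d)))).
rewrite -(mulr1 (ortho_diag V (map_mx expR d))).
rewrite !frameZ !ortho_diag_frameE //.
move: ((V * 1 * U^T) i j : R) => w; rewrite !mxE.
rewrite mulr1 mul1r.
have -> : 2 * (d 0 i * w) - 2 * (w * e 0 j) = (2 * (d 0 i - e 0 j)) * w by ring.
rewrite (mulrAC (expR (- _))) (mulrAC (expR (d 0 i))) -!expRD -mulrBl !normrM.
apply: ler_wpM2r => //; rewrite (@ger0_norm _ 2) //.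
have := sinh_lower_bound (d 0 i - e 0 j); rewrite distrC opprB.
by rewrite (addrC (- d 0 i)) [leRHS]distrC.
Qed.

(** In the eigenbasis the commutator multiplies the entry (i, j) by [d 0 i - d 0 j], a difference of
    two points of [m, M]. *)
Lemma frobenius_commutator (m M : R) V d X : V * V^T = 1 ->
  (forall i, m <= d 0 i <= M) ->
  frobenius (ortho_diag V d * X - X * ortho_diag V d) <= (M - m) * frobenius X.
Proof.
move=> hV dmM; apply: (ortho_diag_frame_le hV hV).
  by have /andP[] := dmM 0; lra.
move=> i j; rewrite frameB.
have -> : ortho_diag V d * X = ortho_diag V d * X * ortho_diag V (const_mx 1).
  by rewrite ortho_diag1 ?mulr1.
have -> : X * ortho_diag V d = ortho_diag V (const_mx 1) * X * ortho_diag V d.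
  by rewrite ortho_diag1 ?mul1r.
rewrite !ortho_diag_frameE // !mxE mulr1 mul1r [X in _ - X]mulrC -mulrBl normrM.
apply: ler_wpM2r => //; rewrite ler_norml.
by have /andP[] := dmM i; have /andP[] := dmM j; lra.
Qed.

(** Square root and inverse square root. The final estimate holds because in the eigenbasis the
    entry (i, j) is divided by the square roots of [d 0 i] and [d 0 j], each at least that of m. *)
Lemma ortho_diag_sqrt (m : R) V d : V * V^T = 1 -> 0 < m ->
  (forall i, m <= d 0 i) ->
  exists B Bi : 'M[R]_n.+1, [/\ B^T = B, B * B = ortho_diag V d,
    B * Bi = 1, Bi * B = 1 &
    forall X, frobenius (Bi * X * Bi) <= m^-1 * frobenius X].
Proof.
move=> hV m0 md; have d0 i : 0 < d 0 i by exact: lt_le_trans (md i).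
pose s i := Num.sqrt (d 0 i).
have s0 i : 0 < s i by rewrite sqrtr_gt0.
exists (ortho_diag V (\row_i s i)), (ortho_diag V (\row_i (s i)^-1)); split.
- exact: ortho_diag_tr.
- rewrite ortho_diagM //; congr ortho_diag; apply/rowP => i; rewrite !mxE.
  by rewrite -expr2 sqr_sqrtr // ltW.
- rewrite ortho_diagM // -[RHS](ortho_diag1 hV); congr ortho_diag.
  by apply/rowP => i; rewrite !mxE mulfV // gt_eqF.
- rewrite ortho_diagM // -[RHS](ortho_diag1 hV); congr ortho_diag.
  by apply/rowP => i; rewrite !mxE mulVf // gt_eqF.
move=> X; apply: (ortho_diag_frame_le hV hV); first by rewrite invr_ge0 ltW.
move=> i j; rewrite ortho_diag_frameE // !mxE mulrAC normrM.
apply: ler_wpM2r => //; rewrite -invfM ger0_norm; last by rewrite invr_ge0 mulr_ge0 ?ltW.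
rewrite lef_pV2 ?posrE ?mulr_gt0 //.
rewrite -(sqr_sqrtr (ltW m0)) expr2; apply: ler_pM; rewrite ?sqrtr_ge0 //.
all: exact: ler_wsqrtr.
Qed.

End Diagonalized.

(* banach_fixed_point is about the entrywise max norm, in which only a high
   enough iterate of f is a contraction. *)
Lemma frobenius_fixpoint (R : realType) (n : nat)
    (f : 'M[R]_n.+1 -> 'M[R]_n.+1) (q : R) : 0 <= q -> q < 1 ->
  (forall X Y, frobenius (f X - f Y) <= q * frobenius (X - Y)) ->
  exists X, f X = X.
Proof.
move=> q0 q1 fq.
have itq k X Y : frobenius (iter k f X - iter k f Y) <= q ^+ k * frobenius (X - Y).
  elim: k => [|k IH]; first by rewrite expr0 mul1r.
  by rewrite exprS -mulrA; apply: le_trans (fq _ _) _; apply: ler_wpM2l.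
(* Enough iterations to absorb the factor [n.+1] lost in passing between the two norms. *)
have [k qk] : exists k, q ^+ k * n.+1%:R < 1.
  have : q ^+ k * n.+1%:R @[k --> \oo] --> (0 : R).
    by rewrite -[0](mul0r n.+1%:R); apply: cvgMr_tmp; apply: cvg_expr; rewrite ger0_norm.
  move/cvgr0_norm_lt => /(_ 1 ltr01) [k _ /(_ k (leqnn k))] /=.
  by move=> h; exists k; apply: le_lt_trans h; exact: ler_norm.
have qk0 : 0 <= q ^+ k * n.+1%:R by rewrite mulr_ge0 ?exprn_ge0.
have qk1 : q ^+ k < 1.
  apply: le_lt_trans qk; rewrite ler_peMr ?exprn_ge0 //; by rewrite ler1n.
pose g : 'M[R]_n.+1 -> 'M[R]_n.+1 := iter k f.
have gfun : set_fun [set: 'M[R]_n.+1] [set: 'M[R]_n.+1] g by [].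
pose G := HB.pack_for {fun [set: 'M[R]_n.+1] >-> [set: 'M[R]_n.+1]} g
  (isFun.Build _ _ _ _ g gfun).
have ctr : is_contraction G.
  exists (NngNum qk0); split => //= -[X Y] _ /=.
  apply: le_trans (norm_le_frobenius _) _.
  apply: le_trans (itq _ _ _) _; rewrite -mulrA; apply: ler_wpM2l.
    by rewrite exprn_ge0.
  exact: frobenius_le_norm.
have [] := banach_fixed_point ctr closedT; first by exists 0.
move=> p _ pE; have {}pE : iter k f p = p by rewrite {2}pE.
(* Both [p] and [f p] are fixed by the k-th iterate, which contracts their distance by [q ^+ k] < 1;
   hence they coincide. *)
exists p; apply/eqP; rewrite -subr_eq0; apply/eqP/frobenius_eq0.
apply/eqP; rewrite eq_le frobenius_ge0 andbT leNgt; apply/negP => h.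
have := itq k (f p) p; rewrite -iterSr iterS pE.
by rewrite -[leLHS]mul1r ler_pM2r // leNgt qk1.
Qed.

(** * Extreme eigenvalues, the norm [anorm], and positive definiteness *)

Section Eigenvalues.
Variables (R : realType) (n : nat).
Implicit Types P V X : 'M[R]_n.+1.
Implicit Types d : 'rV[R]_n.+1.

Lemma eigenvalue_ortho_diag V d (a : R) : V * V^T = 1 ->
  eigenvalue (ortho_diag V d) a <-> exists i, a = d 0 i.
Proof.
move=> hV; have hV' := orthoC hV; split => [/eigenvalueP [v vP v0]|[i ->]].
  pose w := v *m V^T.
  have wd : w *m diag_mx d = a *: w.
    rewrite /w scalemxAl -vP /ortho_diag -!mulmxE -!mulmxA.
    by rewrite [V *m V^T]hV mulmx1.
  have [i wi] : exists i, w 0 i != 0.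
    apply/existsP; apply: contraNT v0 => /existsPn h.
    have w0 : w = 0 by apply/rowP => i; rewrite [RHS]mxE; apply/eqP; move: (h i); rewrite negbK.
    have : w *m V = 0 by rewrite w0 mul0mx.
    by rewrite /w -mulmxA [V^T *m V]hV' mulmx1 => ->.
  exists i; have /rowP/(_ i) := wd; rewrite mul_mx_diag [LHS]mxE [RHS]mxE => h.
  by apply: (mulIf wi); rewrite -h mulrC.
apply/eigenvalueP; exists (row i V).
  rewrite /ortho_diag -!mulmxE -row_mul !mulmxA [V *m V^T]hV mul1mx.
  by rewrite row_mul row_diag_mx -scalemxAl -rowE.
apply/eqP => h; have : row i V *m V^T = 0 by rewrite h mul0mx.
rewrite -row_mul [V *m V^T]hV => /rowP /(_ i); rewrite !mxE eqxx.
by apply/eqP; rewrite oner_eq0.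
Qed.

(** Replaces the infimum and supremum by attained entries of [d], so that the later estimates only
    handle diagonal coefficients. *)
Lemma lambda_ortho_diag V d : V * V^T = 1 ->
  exists i j, [/\ lambda_min (ortho_diag V d) = d 0 i,
    lambda_max (ortho_diag V d) = d 0 j &
    forall k, d 0 i <= d 0 k <= d 0 j].
Proof.
move=> hV.
case: (@arg_minP _ _ _ (ord0 : 'I_n.+1) xpredT (d 0) isT) => i _ di.
case: (@arg_maxP _ _ _ (ord0 : 'I_n.+1) xpredT (d 0) isT) => j _ dj.
have ev k : eigenvalue (ortho_diag V d) (d 0 k).
  by apply/eigenvalue_ortho_diag => //; exists k.
have lbi : lbound [set a | eigenvalue (ortho_diag V d) a] (d 0 i).
  by move=> a /= /(eigenvalue_ortho_diag _ _ hV) [k ->]; exact: di.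
have ubj : ubound [set a | eigenvalue (ortho_diag V d) a] (d 0 j).
  by move=> a /= /(eigenvalue_ortho_diag _ _ hV) [k ->]; exact: dj.
exists i, j; split.
- apply/le_anti/andP; split; first by apply: ge_inf; [exists (d 0 i)|exact: ev].
  by apply: lb_le_inf; [exists (d 0 i); exact: ev|].
- apply/le_anti/andP; split; last by apply: ub_le_sup; [exists (d 0 j)|exact: ev].
  by apply: ge_sup; [exists (d 0 i); exact: ev|].
- by move=> k; apply/andP; split; [exact: di | exact: dj].
Qed.

Lemma spread_le_anorm V d i j : V * V^T = 1 ->
  (forall k, d 0 i <= d 0 k <= d 0 j) ->
  d 0 j - d 0 i <= anorm (ortho_diag V d).
Proof.
move=> hV dij; set P := ortho_diag V d.
(* The quotients are bounded above, without which the supremum would not dominate them. *)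
have bS D : D \is symmetricmx /\ D != 0 ->
    frobenius (D * P - P * D) / frobenius D <= d 0 j - d 0 i.
  move=> [_ D0]; rewrite ler_pdivrMr ?frobenius_gt0 // frobeniusBC.
  exact: frobenius_commutator.
have hS D : D \is symmetricmx /\ D != 0 ->
    frobenius (D * P - P * D) / frobenius D <= anorm P.
  move=> hD; apply: ub_le_sup; last by exists D.
  by exists (d 0 j - d 0 i) => _ [D' hD' <-]; exact: bS.
(* The commutator attains the bound at u v^T + v u^T, with u and v extreme
   eigenvectors. *)
pose Y : 'M[R]_n.+1 := delta_mx i j + delta_mx j i.
have Ys : Y^T = Y by rewrite /Y linearD /= !trmx_delta addrC.
have Y0 : Y != 0.
  (* The indices may coincide, when [P] is scalar; the entry is then 2 instead of 1. *)
  apply/eqP => /matrixP /(_ i j); rewrite !mxE !eqxx /=.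
  by apply/eqP; rewrite -natrD pnatr_eq0.
pose D := V^T * Y * V.
have YD : V * D * V^T = Y.
  by rewrite /D !mulrA hV mul1r -mulrA hV mulr1.
have hD : D \is symmetricmx /\ D != 0.
  split; first by apply/symmetricmxP; rewrite /D !trmxM Ys trmxK mulrA.
  apply: contra_neq Y0 => D0; by rewrite -YD D0 mulr0 mul0r.
apply: le_trans (hS D hD).
rewrite ler_pdivlMr ?frobenius_gt0 ?hD.2 //.
have c0 : 0 <= d 0 j - d 0 i by rewrite subr_ge0; have /andP[] := dij j.
rewrite -[X in X * _](ger0_norm c0) -frobeniusZ -[leRHS]mul1r.
apply: (ortho_diag_frame_le hV hV) => // k l; rewrite mul1r frameZ frameB.
have -> : D * P = ortho_diag V (const_mx 1) * D * P by rewrite ortho_diag1 ?mul1r.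
have -> : P * D = P * D * ortho_diag V (const_mx 1) by rewrite ortho_diag1 ?mulr1.
rewrite !ortho_diag_frameE // YD ![const_mx _ _ _]mxE mul1r mulr1.
rewrite [X in _ <= `|X - _|]mulrC -mulrBl !normrM /Y !mxE.
(* Outside (i, j) and (j, i) the entry of [Y] is 0; at these two places the multiplier has modulus
   exactly [d 0 j - d 0 i]. *)
have [/andP[/eqP -> /eqP ->]|] := boolP ((k == i) && (l == j)).
  by [].
have [/andP[/eqP -> /eqP ->]|_ _] := boolP ((k == j) && (l == i)).
  by rewrite distrC.
by rewrite addr0 normr0 !mulr0.
Qed.

(** Evaluating the quadratic form at the i-th eigenvector, a row of [V], gives [d 0 i]. *)
Lemma posdef_ortho_diag P : posdefmx P ->
  exists V d, [/\ V * V^T = 1, P = ortho_diag V d & forall i, 0 < d 0 i].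
Proof.
move=> [/symmetricmxP Ps Pp]; have [V [d [hV PE]]] := symmetric_ortho_diag Ps.
exists V, d; split => // i; pose x : 'cV[R]_n.+1 := V^T *m delta_mx i 0.
have x0 : x != 0.
  apply/eqP => h; have : V *m x = 0 by rewrite h mulmx0.
  rewrite /x mulmxA [V *m V^T]hV mul1mx => /colP /(_ i).
  by rewrite !mxE !eqxx; apply/eqP; rewrite oner_eq0.
have := Pp x x0; rewrite PE /x /ortho_diag -!mulmxE trmx_mul trmxK trmx_delta.
rewrite -!mulmxA (mulmxA V) [V *m V^T]hV mul1mx (mulmxA V) [V *m V^T]hV mul1mx.
by rewrite mulmxA -rowE -colE !mxE eqxx.
Qed.

End Eigenvalues.

(** * The fixed-point map *)

(** The point is that u' p u - v' p v = u' (p u v' - u v' p) v: two rotated copies of p differ by a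
    commutator. The factors q and qi are inserted to make the outer factors orthogonal in the
    application. *)
Lemma sub_congruence (T : pzRingType) (x y b p q qi u u' v v' : T) :
  q * qi = 1 -> qi * q = 1 -> u' * u = 1 -> v' * v = 1 ->
  x * (b * u' * p * u * b) * y - x * (b * v' * p * v * b) * y =
  x * b * u' * q * (qi * (p * (u * v') - u * v' * p) * qi) * (q * v * b * y).
Proof.
move=> qqi qiq uu vv; rewrite !(mulrBr, mulrBl) !mulrA; congr (_ - _).
  rewrite -(mulrA _ q qi) qqi mulr1 -(mulrA _ qi q) qiq mulr1.
  by rewrite -(mulrA _ v' v) vv mulr1.
rewrite -(mulrA _ q qi) qqi mulr1 -(mulrA _ qi q) qiq mulr1.
by rewrite -(mulrA _ u' u) uu mulr1.
Qed.

(** Since u v' = 1 + (u - v) v' and 1 commutes with p, the commutator is controlled by u - v. *)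
Lemma commutator_sub1 (T : pzRingType) (p u v v' : T) : v * v' = 1 ->
  p * (u * v') - u * v' * p = p * ((u - v) * v') - (u - v) * v' * p.
Proof.
by move=> vv; rewrite !(mulrBl v') vv mulrBr mulr1 mulrBl mul1r opprB addrA subrK.
Qed.

Section Interpolation.
Variables (R : realType) (n : nat) (P0 P1 : 'M[R]_n.+1) (alpha : R).
Variables (V0 V1 : 'M[R]_n.+1) (d0 d1 : 'rV[R]_n.+1) (m0 M0 m1 M1 : R).
Hypotheses (hV0 : V0 * V0^T = 1) (hV1 : V1 * V1^T = 1).
Hypotheses (P0E : P0 = ortho_diag V0 d0) (P1E : P1 = ortho_diag V1 d1).
Hypotheses (hm0 : 0 < m0) (hm1 : 0 < m1).
Hypotheses (hd0 : forall i, m0 <= d0 0 i <= M0).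
Hypotheses (hd1 : forall i, m1 <= d1 0 i <= M1).
Implicit Types Pi X : 'M[R]_n.+1.

Definition shear Pi : 'M[R]_n.+1 := alpha *: (P0 * Pi - Pi * P0).

(** The unknown is split in two: [Pi] in the rotation, [X] elsewhere. The fixed-point map sends [Pi]
    to a solution [X] of [endpoint Pi X = P1], and the original equation is the case [X = Pi]. For
    symmetric [Pi] the transpose is the last exponential of that equation. *)
Definition endpoint Pi X : 'M[R]_n.+1 :=
  expmx (shear Pi) * expmx (- (P0 * X)) * P0 * expmx (- (X * P0))
    * (expmx (shear Pi))^T.

Let P0s : P0^T = P0. Proof. by rewrite P0E ortho_diag_tr. Qed.
Let P1s : P1^T = P1. Proof. by rewrite P1E ortho_diag_tr. Qed.

Lemma shear_skew Pi : Pi^T = Pi -> (shear Pi)^T = - shear Pi.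
Proof.
move=> Ps; rewrite /shear linearZ /= linearB /= !trmxM P0s Ps.
by rewrite -scalerN opprB.
Qed.

Lemma shearB_le Pi1 Pi2 :
  frobenius (shear Pi1 - shear Pi2) <=
  `|alpha| * (M0 - m0) * frobenius (Pi1 - Pi2).
Proof.
have -> : shear Pi1 - shear Pi2 =
    alpha *: (P0 * (Pi1 - Pi2) - (Pi1 - Pi2) * P0).
  by rewrite /shear -scalerBr mulrBr mulrBl opprD addrACA -opprD.
rewrite frobeniusZ -mulrA; apply: ler_wpM2l => //.
by rewrite P0E; exact: frobenius_commutator.
Qed.

(* With B = sqrt P0 and S = B X B, the factors are conjugate to exp (- S). *)
Lemma endpoint_sqrt (B Bi : 'M[R]_n.+1) Pi X :
  B * B = P0 -> B * Bi = 1 -> Bi * B = 1 ->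
  endpoint Pi X = expmx (shear Pi) * B * expmx (- (B * X * B)) *
    expmx (- (B * X * B)) * B * (expmx (shear Pi))^T.
Proof.
move=> BB BBi BiB; rewrite /endpoint.
have -> : - (P0 * X) = B * (- (B * X * B)) * Bi.
  by rewrite mulrN mulNr -!mulrA BBi mulr1 !mulrA BB.
have -> : - (X * P0) = Bi * (- (B * X * B)) * B.
  by rewrite mulrN mulNr !mulrA BiB mul1r -!mulrA BB.
rewrite !expmx_conj // -BB !mulrA -(mulrA _ Bi B) BiB mulr1.
by rewrite -(mulrA _ B Bi) BBi mulr1.
Qed.

(** Origin of the ratio: [Bi] on both sides costs 1/m0 and [Qi] costs 1/m1; the commutators with
    [P0] and [P1] give M0 - m0 and M1 - m1. The 2 of [expmx_skew_lipschitz] cancels against that of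
    [expmx_symmetric_expand]. *)
Lemma endpoint_contraction Pi1 Pi2 X1 X2 :
  Pi1^T = Pi1 -> Pi2^T = Pi2 -> X1^T = X1 -> X2^T = X2 ->
  endpoint Pi1 X1 = P1 -> endpoint Pi2 X2 = P1 ->
  frobenius (X1 - X2) <=
  `|alpha| * (M0 - m0) * (M1 - m1) / (m0 * m1) * frobenius (Pi1 - Pi2).
Proof.
move=> Pi1s Pi2s X1s X2s e1 e2.
have [B [Bi [Bs]]] := ortho_diag_sqrt hV0 hm0 (fun i => proj1 (andP (hd0 i))).
rewrite -P0E => BB BBi BiB Bbound.
have [Q [Qi [Qs]]] := ortho_diag_sqrt hV1 hm1 (fun i => proj1 (andP (hd1 i))).
rewrite -P1E => QQ QQi QiQ Qbound.
have Bis : Bi^T = Bi.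
  by rewrite -[LHS]mulr1 -BBi mulrA -{1}Bs -trmxM BBi [1^T]trmx1 mul1r.
have Qis : Qi^T = Qi.
  by rewrite -[LHS]mulr1 -QQi mulrA -{1}Qs -trmxM QQi [1^T]trmx1 mul1r.
pose S X := B * X * B.
have Ss X : X^T = X -> (S X)^T = S X.
  by move=> Xs; rewrite /S !trmxM Bs Xs mulrA.
pose U Pi := expmx (shear Pi).
have UU Pi : Pi^T = Pi -> U Pi * (U Pi)^T = 1.
  by move=> Ps; apply: expmx_skew_ortho; exact: shear_skew.
have XS X : X = Bi * S X * Bi.
  by rewrite /S !mulrA BiB mul1r -mulrA BBi mulr1.
have square Pi X : Pi^T = Pi -> endpoint Pi X = P1 ->
    expmx (- S X) * expmx (- S X) = Bi * (U Pi)^T * P1 * U Pi * Bi.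
  move=> Ps <-; rewrite (endpoint_sqrt _ _ BB BBi BiB) -/(S X) -/(U Pi).
  rewrite !mulrA -(mulrA _ (U Pi)^T (U Pi)) (orthoC (UU _ Ps)) mulr1.
  rewrite -(mulrA _ B Bi) BBi mulr1 -(mulrA _ (U Pi)^T (U Pi)) (orthoC (UU _ Ps)).
  by rewrite mulr1 BiB mul1r.
(* By [square], Z Z^T = e^S e^(-2S) e^S = 1. These orthogonal matrices gather all the unbounded
   factors around the commutator. *)
pose Z Pi X := expmx (S X) * Bi * (U Pi)^T * Q.
have Zt Pi X : X^T = X -> (Z Pi X)^T = Q * U Pi * Bi * expmx (S X).
  by move=> Xs; rewrite /Z !trmxM Qs trmxK Bis -expmx_tr Ss // !mulrA.
have ZZ Pi X : Pi^T = Pi -> X^T = X -> endpoint Pi X = P1 ->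
    Z Pi X * (Z Pi X)^T = 1.
  move=> Ps Xs e; rewrite Zt // /Z !mulrA -(mulrA _ Q Q) QQ.
  rewrite -2!(mulrA (expmx (S X))) -3!(mulrA (expmx (S X))).
  rewrite -(square Pi X) // !mulrA (expmxMN (S X)) mul1r.
  exact: expmxNM.
(* Both products on the left have the form e^(S1) Y e^(S2), with Y = e^(-2 S1) and Y = e^(-2 S2); by
   [square] each Y is a congruence of [P1]. *)
have key : expmx (- S X1) * expmx (S X2) - expmx (S X1) * expmx (- S X2) =
    Z Pi1 X1 * (Qi * (P1 * (U Pi1 * (U Pi2)^T) - (U Pi1 * (U Pi2)^T) * P1) * Qi)
      * (Z Pi2 X2)^T.
  have -> : expmx (- S X1) * expmx (S X2) =
      expmx (S X1) * (expmx (- S X1) * expmx (- S X1)) * expmx (S X2).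
    by rewrite !mulrA (expmxMN (S X1)) mul1r.
  have -> : expmx (S X1) * expmx (- S X2) =
      expmx (S X1) * (expmx (- S X2) * expmx (- S X2)) * expmx (S X2).
    by rewrite -!mulrA (expmxNM (S X2)) mulr1.
  rewrite (square Pi1) // (square Pi2) // Zt // /Z.
  exact: sub_congruence QQi QiQ (orthoC (UU _ Pi1s)) (orthoC (UU _ Pi2s)).
have comm : frobenius (Qi * (P1 * (U Pi1 * (U Pi2)^T) - (U Pi1 * (U Pi2)^T) * P1) * Qi)
    <= m1^-1 * ((M1 - m1) * (2 * (`|alpha| * (M0 - m0) * frobenius (Pi1 - Pi2)))).
  apply: le_trans (Qbound _) _; apply: ler_wpM2l; first by rewrite invr_ge0 ltW.
  have -> : P1 * (U Pi1 * (U Pi2)^T) - (U Pi1 * (U Pi2)^T) * P1 =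
      P1 * ((U Pi1 - U Pi2) * (U Pi2)^T) - ((U Pi1 - U Pi2) * (U Pi2)^T) * P1.
    exact: commutator_sub1 (UU _ Pi2s).
  have M1m1 : 0 <= M1 - m1 by have /andP[] := hd1 0; lra.
  rewrite {1 2}P1E; apply: le_trans (frobenius_commutator _ hV1 hd1) _.
  apply: ler_wpM2l => //.
  rewrite frobenius_orthoMr; last by rewrite trmxK; apply: orthoC; exact: UU.
  apply: le_trans (expmx_skew_lipschitz (shear_skew Pi1s) (shear_skew Pi2s)) _.
  by apply: ler_wpM2l => //; exact: shearB_le.
have Sle : 2 * frobenius (S X1 - S X2) <=
    m1^-1 * ((M1 - m1) * (2 * (`|alpha| * (M0 - m0) * frobenius (Pi1 - Pi2)))).
  apply: le_trans (expmx_symmetric_expand (Ss _ X1s) (Ss _ X2s)) _.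
  by rewrite key frobenius_conj ?ZZ.
have -> : X1 - X2 = Bi * (S X1 - S X2) * Bi by rewrite mulrBr mulrBl -!XS.
apply: le_trans (Bbound _) _.
rewrite -(ler_pM2l (ltr0Sn R 1)) mulrCA.
apply: le_trans (ler_wpM2l _ Sle) _; first by rewrite invr_ge0 ltW.
rewrite le_eqVlt; apply/orP; left; apply/eqP; field.
by rewrite !gt_eqF.
Qed.

(** The equation amounts to e^(-2S) = [Y] with S = B X B. As [Y] is congruent to [P1], it is
    positive definite, and S is minus half its logarithm, taken in an eigenbasis. *)
Lemma endpoint_solvable Pi : posdefmx P1 -> Pi^T = Pi ->
  exists2 X, X^T = X & endpoint Pi X = P1.
Proof.
move=> posP1 Pis.
have [B [Bi [Bs]]] := ortho_diag_sqrt hV0 hm0 (fun i => proj1 (andP (hd0 i))).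
rewrite -P0E => BB BBi BiB _.
have Bis : Bi^T = Bi.
  by rewrite -[LHS]mulr1 -BBi mulrA -{1}Bs -trmxM BBi [1^T]trmx1 mul1r.
pose U := expmx (shear Pi).
have UU : U * U^T = 1 by apply: expmx_skew_ortho; exact: shear_skew.
pose Y := Bi * U^T * P1 * U * Bi.
have posY : posdefmx Y.
  split; first by apply/symmetricmxP; rewrite /Y !trmxM P1s trmxK Bis !mulrA.
  move=> x x0; pose y := U *m (Bi *m x).
  have -> : x^T *m Y *m x = y^T *m P1 *m y.
    by rewrite /y /Y !trmx_mul Bis -!mulmxE !mulmxA.
  apply: (proj2 posP1); apply: contra_neq x0 => y0.
  have -> : x = B *m (U^T *m y).
    by rewrite /y (mulmxA U^T) [U^T *m U](orthoC UU) mul1mx mulmxA [B *m Bi]BBi mul1mx.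
  by rewrite y0 !mulmx0.
have [V [d [hV YE dpos]]] := posdef_ortho_diag posY.
pose S := ortho_diag V (map_mx (fun t => - ln t / 2) d).
have Ss : S^T = S by rewrite ortho_diag_tr.
have E2 : expmx (- S) * expmx (- S) = Y.
  rewrite ortho_diagN expmx_ortho_diag // ortho_diagM // YE.
  congr ortho_diag; apply/rowP => i; rewrite !mxE -expRD.
  by rewrite mulNr opprK -splitr lnK ?posrE.
exists (Bi * S * Bi); first by rewrite 2!trmxM Ss Bis mulrA.
rewrite (endpoint_sqrt _ _ BB BBi BiB) -/U.
have -> : B * (Bi * S * Bi) * B = S.
  by rewrite !mulrA BBi mul1r -mulrA BiB mulr1.
rewrite -!mulrA (mulrA (expmx _) (expmx _)) E2 /Y !mulrA.
rewrite -(mulrA _ B Bi) BBi mulr1 UU mul1r -(mulrA _ Bi B) BiB mulr1.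
by rewrite -mulrA UU mulr1.
Qed.

End Interpolation.

(** When s = 0 the quotient is infinite and the hypothesis is void, but the conclusion reads 0 <
    r. *)
Lemma lte_div_mul (R : realType) (a r s : R) : 0 < r -> 0 <= s ->
  (a%:E < r%:E / s%:E)%E -> a * s < r.
Proof.
move=> r0; rewrite le_eqVlt => /predU1P[<-|s0]; first by rewrite mulr0.
by rewrite inver gt_eqF // -EFinM lte_fin ltr_pdivlMr.
Qed.

(* Division on \bar R satisfies r%:E / 0 = +oo for r > 0. *)
Theorem theorem2 (R : realType) (n : nat) (P0 P1 : 'M[R]_n.+1) (alpha : R) :
  posdefmx P0 -> posdefmx P1 ->
  (`|alpha|%:E <
     Order.max
       ((lambda_min P0 * lambda_min P1)%:E / (anorm P0 * lambda_max P1)%:E)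
       ((lambda_min P0 * lambda_min P1)%:E / (anorm P1 * lambda_max P0)%:E))%E ->
  exists! Pi : 'M[R]_n.+1,
    Pi \is symmetricmx /\
    expmx (alpha *: (P0 * Pi - Pi * P0)) * expmx (- (P0 * Pi)) * P0
      * expmx (- (Pi * P0)) * expmx (alpha *: (Pi * P0 - P0 * Pi)) = P1.
Proof.
move=> pos0 pos1; rewrite lt_max => small.
have [V0 [d0 [hV0 P0E d0pos]]] := posdef_ortho_diag pos0.
have [V1 [d1 [hV1 P1E d1pos]]] := posdef_ortho_diag pos1.
have [i0 [j0 [min0 max0 bd0]]] := lambda_ortho_diag d0 hV0.
have [i1 [j1 [min1 max1 bd1]]] := lambda_ortho_diag d1 hV1.
have spread0 := spread_le_anorm hV0 bd0.
have spread1 := spread_le_anorm hV1 bd1.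
rewrite -P0E in min0 max0 spread0; rewrite -P1E in min1 max1 spread1.
have m0M0 : d0 0 i0 <= d0 0 j0 by have /andP[] := bd0 j0.
have m1M1 : d1 0 i1 <= d1 0 j1 by have /andP[] := bd1 j1.
have m0 := d0pos i0; have m1 := d1pos i1.
have small' : `|alpha| * (d0 0 j0 - d0 0 i0) * (d1 0 j1 - d1 0 i1) <
    d0 0 i0 * d1 0 i1.
  (* In either quotient of the maximum, one spread is bounded by [anorm] and the other by the
     largest eigenvalue, the least one being positive. Both cases bound the same product of
     spreads. *)
  have aux s t a b : 0 <= t -> t <= s -> 0 <= b -> b <= a ->
      (`|alpha|%:E < (d0 0 i0 * d1 0 i1)%:E / (s * a)%:E)%E ->
      `|alpha| * (t * b) < d0 0 i0 * d1 0 i1.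
    move=> t0 ts b0 ba /lte_div_mul h; apply: le_lt_trans (h _ _).
    - by apply: ler_wpM2l => //; exact: ler_pM.
    - exact: mulr_gt0.
    - by apply: mulr_ge0; [exact: le_trans t0 ts | exact: le_trans b0 ba].
  rewrite -mulrA; case/orP: small; rewrite min0 min1 ?max0 ?max1.
    by apply: aux => //; lra.
  by rewrite (mulrC (_ - _)); apply: aux => //; lra.
set q := `|alpha| * (d0 0 j0 - d0 0 i0) * (d1 0 j1 - d1 0 i1) / (d0 0 i0 * d1 0 i1).
have q1 : q < 1 by rewrite ltr_pdivrMr ?mul1r // mulr_gt0.
have q0 : 0 <= q.
  by rewrite divr_ge0 ?mulr_ge0 ?subr_ge0 // ltW.
have contr := endpoint_contraction hV0 hV1 P0E P1E m0 m1 bd0 bd1.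
have endE X : X^T = X ->
    expmx (alpha *: (P0 * X - X * P0)) * expmx (- (P0 * X)) * P0
      * expmx (- (X * P0)) * expmx (alpha *: (X * P0 - P0 * X)) =
    endpoint P0 alpha X X.
  move=> Xs; rewrite /endpoint -expmx_tr (shear_skew _ P0E Xs).
  by rewrite /shear -scalerN opprB.
(* The fixed-point lemma needs a map on all matrices, while the equation is solved for symmetric
   [Pi] only. Taking the symmetric part first does not increase distances, and a fixed point is
   symmetric because the values of the map are. *)
pose sym (X : 'M[R]_n.+1) : 'M[R]_n.+1 := (2^-1 : R) *: (X + X^T).
have symT X : (sym X)^T = sym X.
  by rewrite /sym linearZ /= linearD /= trmxK addrC.
have symK X : X^T = X -> sym X = X.
  by move=> Xs; rewrite /sym Xs -mulr2n -[X *+ 2]scaler_nat scalerA mulVf ?scale1r.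
have symB X Y : frobenius (sym X - sym Y) <= frobenius (X - Y).
  have -> : sym X - sym Y = (2^-1 : R) *: ((X - Y) + (X - Y)^T).
    by rewrite /sym -scalerBr [(X - Y)^T]linearB opprD addrACA.
  rewrite frobeniusZ ger0_norm // ler_pdivrMl //.
  by apply: le_trans (frobeniusD _ _) _; rewrite frobenius_tr; lra.
have solv Pi : exists X, X^T = X /\ endpoint P0 alpha (sym Pi) X = P1.
  have [X] := endpoint_solvable alpha hV0 P0E P1E m0 bd0 pos1 (symT Pi).
  by exists X.
have [f fP] := choice solv.
have [X fX] : exists X, f X = X.
  apply: (frobenius_fixpoint q0 q1) => X Y.
  have [[fXs fXe] [fYs fYe]] := (fP X, fP Y).
  apply: le_trans (contr _ _ _ _ _ (symT X) (symT Y) fXs fYs fXe fYe) _.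
  by apply: ler_wpM2l.
have [fXs fXe] := fP X; rewrite fX in fXs fXe; rewrite (symK _ fXs) in fXe.
exists X; split; first by split; [exact/symmetricmxP | rewrite endE].
move=> Y [/symmetricmxP Ys]; rewrite endE // => Ye.
(* Each solution is its own image under the contraction, so their distance is at most q times
   itself. *)
have := contr _ _ _ _ _ fXs Ys fXs Ys fXe Ye; rewrite -/q => le_q.
apply/eqP; rewrite -subr_eq0; apply/eqP/frobenius_eq0.
have := frobenius_ge0 (X - Y); rewrite le_eqVlt => /predU1P[<-//|h].
by move: le_q; rewrite -[leLHS]mul1r ler_pM2r // leNgt q1.
Qed.
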